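(* For every even integer $d\ge4$, $$p_{\min}(d)=p^{\mathrm{PPT}}\big(|\omega_d^\Omega\rangle\langle\omega_d^\Omega|\big)=\frac1{d+2}.$$
   Context: Let $F_d=\sum_{i,j=1}^d|ij\rangle\langle ji|$ be the flip operator and $\Pi_{\mathcal{A}}=\frac12(I_{d^2}-F_d)$ the orthogonal projection onto the antisymmetric subspace $\mathbb{C}^d\wedge\mathbb{C}^d$ of $\mathbb{C}^d\otimes\mathbb{C}^d$. A quantum state is a positive semidefinite trace-one matrix; it is PPT if its partial transpose $(\mathrm{id}\otimes\top)(\sigma)$ is positive semidefinite. An antisymmetric state is a state $\rho_{\mathcal{A}}$ on $\mathbb{C}^d\otimes\mathbb{C}^d$ with $\Pi_{\mathcal{A}}\rho_{\mathcal{A}}\Pi_{\mathcal{A}}=\rho_{\mathcal{A}}$. For such a state define $$p^{\mathrm{PPT}}(\rho_{\mathcal{A}})=\max\{\operatorname{Tr}(\Pi_{\mathcal{A}}\sigma):\ \sigma\text{ a PPT state on }\mathbb{C}^d\otimes\mathbb{C}^d,\ \Pi_{\mathcal{A}}\sigma\Pi_{\mathcal{A}}=\operatorname{Tr}(\Pi_{\mathcal{A}}\sigma)\rho_{\mathcal{A}}\},$$ and $p_{\min}(d)=\min_{\rho_{\mathcal{A}}}p^{\mathrm{PPT}}(\rho_{\mathcal{A}})$, the minimum over all antisymmetric states on $\mathbb{C}^d\otimes\mathbb{C}^d$. Finally $\Omega_d=\begin{pmatrix}0&I_{d/2}\\-I_{d/2}&0\end{pmatrix}$ and $|\omega_d^\Omega\rangle=(I_d\otimes\Omega_d)\frac1{\sqrt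 d}\sum_{j=1}^d|jj\rangle=\frac1{\sqrt d}\sum_{i=1}^{d/2}\big(|i+\tfrac d2,i\rangle-|i,i+\tfrac d2\rangle\big)$ up to a global sign, which does not affect $|\omega_d^\Omega\rangle\langle\omega_d^\Omega|$. *)

(* Defs.v *)
From mathcomp Require Export all_boot all_order all_algebra.
From mathcomp Require Export classical_sets reals.
From mathcomp.real_closed Require Export complex mxtens.

Set Implicit Arguments.
Unset Strict Implicit.
Unset Printing Implicit Defensive.

Import Order.TTheory GRing.Theory Num.Theory.

Local Open Scope ring_scope.
Local Open Scope complex_scope.
Local Open Scope sesquilinear_scope.
Local Open Scope classical_set_scope.

(* C^m (x) C^n is 'cV_(m * n), with |i j> the basis vector of index
   mxtens_index (i, j); this is the convention of tensmx. *)

Section States.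
Variable R : realType.
Local Notation C := R[i].

Definition ket2 d (i j : 'I_d) : 'cV[C]_(d * d) :=
  delta_mx (mxtens_index (i, j)) 0.

Definition flip d : 'M[C]_(d * d) :=
  \sum_(i < d) \sum_(j < d) ket2 i j *m (ket2 j i) ^t*.

Definition asym_proj d : 'M[C]_(d * d) := 2^-1 *: (1%:M - flip d).

Definition psd n (A : 'M[C]_n) : Prop :=
  A \is hermsymmx /\ forall v : 'cV[C]_n, 0 <= (v ^t* *m A *m v) 0 0.

Definition state n (rho : 'M[C]_n) : Prop := psd rho /\ \tr rho = 1.

(* <i j| (id (x) T)(sigma) |k l> = <i l| sigma |k j>. *)
Definition partial_transpose d (sigma : 'M[C]_(d * d)) : 'M[C]_(d * d) :=
  \matrix_(r, c)
    sigma (mxtens_index ((mxtens_unindex r).1, (mxtens_unindex c).2))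
          (mxtens_index ((mxtens_unindex c).1, (mxtens_unindex r).2)).

Definition PPT_state d (sigma : 'M[C]_(d * d)) : Prop :=
  state sigma /\ psd (partial_transpose sigma).

Definition antisym_state d (rho : 'M[C]_(d * d)) : Prop :=
  state rho /\ asym_proj d *m rho *m asym_proj d = rho.

(* Greatest and least element of a set of reals, 0 by convention if there is
   none.  The convention cannot help to make pmin positive: if pPPT rho were
   not an attained maximum for some antisymmetric rho, or if the minimum over
   rho were not attained, then pmin would be at most 0. *)
Definition maximum (A : set R) : R := xget 0 (A `&` ubound A).
Definition minimum (A : set R) : R := xget 0 (A `&` lbound A).

Definition pPPT d (rho : 'M[C]_(d * d)) : R :=
  maximum [set complex.Re (\tr (asym_proj d *m sigma)) | sigma in
    [set sigma : 'M[C]_(d * d) | PPT_state sigma /\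
       asym_proj d *m sigma *m asym_proj d
         = \tr (asym_proj d *m sigma) *: rho]].

Definition pmin d : R :=
  minimum [set pPPT rho | rho in [set rho : 'M[C]_(d * d) | antisym_state rho]].

(* The block matrix (0, I; -I, 0) with blocks of size d / 2 (d even). *)
Definition Omega d : 'M[C]_d :=
  \matrix_(i, j) ((j == (i + d./2)%N :> nat)%:R - (i == (j + d./2)%N :> nat)%:R).

Definition omega d : 'cV[C]_(d * d) :=
  tensmx 1%:M (Omega d) *m
    ((Num.sqrt (d%:R : R))^-1%:C *: \sum_(j < d) ket2 j j).

Definition omega_state d : 'M[C]_(d * d) := omega d *m (omega d) ^t*.

End States.

(* Main.v *)
From HB Require Import structures.
Require Import Defs.
From mathcomp Require Import boolp functions topology normedtype derive.
From mathcomp Require Import ring zify.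
Set Implicit Arguments.
Unset Strict Implicit.
Unset Printing Implicit Defensive.
Import Order.TTheory GRing.Theory Num.Theory.
Import numFieldNormedType.Exports.
Local Open Scope ring_scope.
Local Open Scope sesquilinear_scope.
Local Open Scope classical_set_scope.

(** Write |A> for the vector with coordinates A_ij and F for the flip.

    Lower bound: an antisymmetric state is a sum of projectors |A><A| with
    A antisymmetric, and the partial transpose of |A><A| is (A (x) A^* ) F.
    With X = (A A^* )^(1/2) this is bounded below by - X (x) X^T, which is the
    negative of the partial transpose of X (x) X, while the partial transpose
    of F (X (x) X) is |X><X| >= 0.  Hence |A><A| + (1 + F)(X (x) X) is PPT; its
    symmetric part has trace (tr X)^2 + tr X^2 <= (d + 1) tr (A A^* ).

    Upper bound for omega: with G = d PT(omega) one has G^2 = 1 and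
    G Phi = - Phi for the maximally entangled projector Phi, so that
    K = (1 - G) / 2 - Phi is a projector, and 0 <= tr (PT(sigma) K) reads
    (d - 2) (1 - (d + 2) p) >= 0.

    The maximum defining pPPT is attained because the feasible set is
    compact. *)

(** * Positive semidefinite matrices *)

Section Adjoint.
Variable C : numClosedFieldType.

Lemma adjmxM m n p (A : 'M[C]_(m, n)) (B : 'M[C]_(n, p)) :
  (A *m B)^t* = B^t* *m A^t*.
Proof. by rewrite trmx_mul map_mxM. Qed.

Lemma adjmxD m n (A B : 'M[C]_(m, n)) : (A + B)^t* = A^t* + B^t*.
Proof. by rewrite linearD map_mxD. Qed.

Lemma adjmxB m n (A B : 'M[C]_(m, n)) : (A - B)^t* = A^t* - B^t*.
Proof. by rewrite linearB map_mxB. Qed.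

Lemma adjmxZ m n a (A : 'M[C]_(m, n)) : (a *: A)^t* = a^* *: A^t*.
Proof. by rewrite linearZ map_mxZ. Qed.

Lemma adjmx1 n : (1%:M : 'M[C]_n)^t* = 1%:M.
Proof. by rewrite trmx1 map_mx1. Qed.

Lemma adjmx_tens m n p q (A : 'M[C]_(m, n)) (B : 'M[C]_(p, q)) :
  (A *t B)^t* = A^t* *t B^t*.
Proof. by rewrite trmx_tens map_mxT. Qed.

Lemma mxtrace_gram m n (A : 'M[C]_(m, n)) :
  \tr (A *m A^t*) = \sum_i \sum_j `|A i j| ^+ 2.
Proof.
rewrite /mxtrace; apply: eq_bigr => i _; rewrite mxE.
by apply: eq_bigr => j _; rewrite !mxE normCK.
Qed.

Lemma sqrt_diag_gram n (D : 'rV[C]_n) : (forall i, 0 <= D 0 i) ->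
  diag_mx (map_mx sqrtC D) *m (diag_mx (map_mx sqrtC D))^t* = diag_mx D.
Proof.
move=> D0; rewrite tr_diag_mx map_diag_mx mulmx_diag; congr diag_mx.
by apply/rowP=> i; rewrite !mxE /= geC0_conj ?sqrtC_ge0 // -expr2 sqrtCK.
Qed.

(** Cauchy-Schwarz against the identity: it is tr Y^2 >= 0 for the traceless part Y = X - (tr X / n)
    1. *)
Lemma mxtrace_sqr_le n (X : 'M[C]_n) : X^t* = X ->
  (\tr X) ^+ 2 <= n%:R * \tr (X *m X).
Proof.
move=> hX; case: n => [|n] in X hX *.
  by rewrite /mxtrace big_ord0 expr0n mul0r.
set t := \tr X; pose c := t / n.+1%:R; pose Y := X - c *: 1%:M.
have cR : c^* = c.
  have tR : t^* = t by rewrite /t -[in RHS]hX trace_map_mx mxtrace_tr.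
  by rewrite rmorphM fmorphV rmorph_nat /= tR.
have hY : Y^t* = Y by rewrite adjmxB hX adjmxZ adjmx1 cR.
have : 0 <= \tr (Y *m Y^t*).
  rewrite mxtrace_gram; apply: sumr_ge0 => i _; apply: sumr_ge0 => j _.
  by rewrite exprn_ge0.
rewrite hY mulmxBl !mulmxBr -!scalemxAl -!scalemxAr !mulmx1 mul1mx.
rewrite !raddfB /= !mxtraceZ mxtrace1 -/t.
rewrite opprK -(pmulr_rge0 _ (ltr0Sn C n)) -[t ^+ 2 <= _]subr_ge0.
suff -> : n.+1%:R * \tr (X *m X) - t ^+ 2 =
  n.+1%:R * (\tr (X *m X) - c * t + (- (c * t) + c * (c * n.+1%:R))) by [].
by rewrite /c; field; rewrite nat1r pnatr_eq0.
Qed.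

Lemma quad_delta n (A : 'M[C]_n) i j :
  ((delta_mx i 0 : 'cV[C]_n)^t* *m A *m (delta_mx j 0 : 'cV[C]_n)) 0 0 = A i j.
Proof. by rewrite trmx_delta map_delta_mx -rowE -colE !mxE. Qed.

Lemma quad_delta_comb n (A : 'M[C]_n) i j c :
  ((delta_mx i 0 + c *: delta_mx j 0 : 'cV_n)^t* *m A *m
    (delta_mx i 0 + c *: delta_mx j 0 : 'cV_n)) 0 0 =
  A i i + c * A i j + (c^* * A j i + c^* * c * A j j).
Proof.
have mxD (X Y : 'M[C]_1) : (X + Y) 0 0 = X 0 0 + Y 0 0 by rewrite mxE.
have mxZ a (X : 'M[C]_1) : (a *: X) 0 0 = a * X 0 0 by rewrite mxE.
rewrite adjmxD adjmxZ !mulmxDl !mulmxDr -!scalemxAl -!scalemxAr.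
by rewrite !(mxD, mxZ) !quad_delta; ring.
Qed.

End Adjoint.

Section Psd.
Variable R : realType.
Local Notation C := R[i]%C.

Lemma psd_adj n (A : 'M[C]_n) : psd A -> A^t* = A.
Proof. by case=> /is_hermitianmxP + _; rewrite expr0 scale1r => <-. Qed.

Lemma psd_quad n (A : 'M[C]_n) (v : 'cV[C]_n) :
  psd A -> 0 <= (v^t* *m A *m v) 0 0.
Proof. by case=> _; exact. Qed.

Lemma psd_intro n (A : 'M[C]_n) :
  A^t* = A -> (forall v : 'cV[C]_n, 0 <= (v^t* *m A *m v) 0 0) -> psd A.
Proof.
by move=> hA pA; split; first by apply/is_hermitianmxP; rewrite expr0 scale1r hA.
Qed.

Lemma psd_gram m n (A : 'M[C]_(m, n)) : psd (A *m A^t*).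
Proof.
apply: psd_intro => [|v]; first by rewrite adjmxM trmxCK.
rewrite mulmxA -mulmxA -[A^t* *m v]trmxCK adjmxM trmxCK.
by rewrite mxE; apply: sumr_ge0 => i _; rewrite !mxE mul_conjC_ge0.
Qed.

Lemma psdD n (A B : 'M[C]_n) : psd A -> psd B -> psd (A + B).
Proof.
move=> pA pB; apply: psd_intro => [|v]; first by rewrite adjmxD !psd_adj.
by rewrite mulmxDr mulmxDl mxE addr_ge0 ?psd_quad.
Qed.

Lemma psdZ n a (A : 'M[C]_n) : 0 <= a -> psd A -> psd (a *: A).
Proof.
move=> a0 pA; apply: psd_intro => [|v].
  by rewrite adjmxZ psd_adj // conj_Creal // ger0_real.
by rewrite -scalemxAr -scalemxAl mxE mulr_ge0 ?psd_quad.
Qed.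

Lemma psd0 n : psd (0 : 'M[C]_n).
Proof. by have := psd_gram (0 : 'M[C]_(n, n)); rewrite mul0mx. Qed.

Lemma psd_sum n (I : finType) (A : I -> 'M[C]_n) :
  (forall i, psd (A i)) -> psd (\sum_i A i).
Proof.
move=> pA; apply: (big_ind (@psd R n)) => [|B D|i _]; [exact: psd0|exact: psdD|].
exact: pA.
Qed.

Lemma psd_congr m n (K : 'M[C]_(m, n)) (A : 'M[C]_n) :
  psd A -> psd (K *m A *m K^t*).
Proof.
move=> pA; apply: psd_intro => [|v].
  by rewrite !adjmxM trmxCK psd_adj // mulmxA.
by have := psd_quad (K^t* *m v) pA; rewrite adjmxM trmxCK !mulmxA.
Qed.

Lemma psd_diag_ge0 n (A : 'M[C]_n) i : psd A -> 0 <= A i i.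
Proof. by case=> _ /(_ (delta_mx i 0)); rewrite quad_delta. Qed.

Lemma psd_mxtrace_ge0 n (A : 'M[C]_n) : psd A -> 0 <= \tr A.
Proof. by move=> pA; apply: sumr_ge0 => i _; exact: psd_diag_ge0. Qed.

Lemma psd_proj n (P : 'M[C]_n) : P^t* = P -> P *m P = P -> psd P.
Proof. by move=> hP PP; rewrite -PP -{2}hP; exact: psd_gram. Qed.

Lemma psd_spectral n (A : 'M[C]_n) : psd A ->
  exists U : 'M[C]_n, exists D : 'rV[C]_n,
  [/\ U \is unitarymx, A = U^t* *m diag_mx D *m U & forall i, 0 <= D 0 i].
Proof.
move=> pA; have [hA _] := pA.
have U_unit := spectral_unitarymx A.
have /orthomx_spectralP := hermitian_normalmx hA; rewrite invmx_unitary // => Adef.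
exists (spectralmx A), (spectral_diag A); split=> // i.
(* Each eigenvalue is a diagonal entry of U A U^*, which is again positive semidefinite. *)
suff <- : (spectralmx A *m A *m (spectralmx A)^t*) i i = spectral_diag A 0 i.
  exact/psd_diag_ge0/psd_congr.
rewrite {2}Adef !mulmxA; have /unitarymxP -> := U_unit.
by rewrite mul1mx mulmxtVK // !mxE eqxx.
Qed.

Lemma psd_gramP n (A : 'M[C]_n) : psd A -> exists L : 'M[C]_n, A = L *m L^t*.
Proof.
move=> /psd_spectral[U [D [Uu -> D0]]].
exists (U^t* *m diag_mx (map_mx sqrtC D)).
by rewrite adjmxM trmxCK -(sqrt_diag_gram D0) !mulmxA.
Qed.

End Psd.

(** * The flip and the partial transpose *)

(** This identification turns the flip into transposition, the inner product into the
    Hilbert-Schmidt product and local operators into two-sided multiplication. *)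
Definition tvec (C : numClosedFieldType) d (A : 'M[C]_d) : 'cV[C]_(d * d) :=
  \col_r A (mxtens_unindex r).1 (mxtens_unindex r).2.

Lemma tvecE (C : numClosedFieldType) d (A : 'M[C]_d) i j k :
  tvec A (mxtens_index (i, j)) k = A i j.
Proof. by rewrite mxE mxtens_indexK. Qed.

Lemma tensmx_matrixP (T : Type) m n p q (A B : 'M[T]_(m * n, p * q)) :
  (forall i j k l, A (mxtens_index (i, j)) (mxtens_index (k, l)) =
                   B (mxtens_index (i, j)) (mxtens_index (k, l))) -> A = B.
Proof.
move=> AB; apply/matrixP=> r c.
by case: (mxtens_indexP r) => i j; case: (mxtens_indexP c) => k l.
Qed.

Lemma tensmx1 (S : comPzRingType) m n : (1%:M : 'M[S]_m) *t (1%:M : 'M[S]_n) = 1%:M.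
Proof.
apply: tensmx_matrixP => i j k l; rewrite tensmxE !mxE.
by rewrite (can_eq (@mxtens_indexK m n)) xpair_eqE -natrM mulnb.
Qed.

Lemma mxtrace_tens (S : comPzRingType) m n (A : 'M[S]_m) (B : 'M[S]_n) :
  \tr (A *t B) = \tr A * \tr B.
Proof.
by rewrite /mxtrace mulr_sum; apply: eq_bigr => i _; rewrite mxE.
Qed.

Lemma sum_mxtens (S : nmodType) m n (f : 'I_(m * n) -> S) :
  \sum_r f r = \sum_i \sum_j f (mxtens_index (i, j)).
Proof.
rewrite pair_big /= (reindex (@mxtens_index m n)) /=.
  by apply: eq_bigr => -[i j] _.
by exists (@mxtens_unindex m n) => ? _; rewrite ?mxtens_indexK ?mxtens_unindexK.
Qed.

Section Flip.
Variables (R : realType) (d : nat).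
Local Notation C := R[i]%C.
Local Notation F := (flip R d).
Local Notation Pi := (asym_proj R d).
Local Notation PT := (@partial_transpose R d).

Lemma flipE i j k l :
  F (mxtens_index (i, j)) (mxtens_index (k, l)) = ((i == l) && (j == k))%:R.
Proof.
rewrite /flip summxE (bigD1 i) //= summxE (bigD1 j) //=.
rewrite !big1 ?addr0; last 2 first.
- move=> i' ne; rewrite summxE big1 // => j' _; rewrite /ket2 mxE big_ord1 !mxE.
  rewrite (can_eq (@mxtens_indexK d d)) xpair_eqE.
  by rewrite [i == i']eq_sym (negPf ne) mul0r.
- move=> j' ne; rewrite /ket2 mxE big_ord1 !mxE.
  rewrite (can_eq (@mxtens_indexK d d)) xpair_eqE.
  by rewrite eqxx [j == j']eq_sym (negPf ne) mul0r.
rewrite /ket2 mxE big_ord1 !mxE /= !(can_eq (@mxtens_indexK d d)) !xpair_eqE.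
rewrite !eqxx mul1r.
by rewrite /= !andbT conjC_nat andbC [l == _]eq_sym [k == _]eq_sym.
Qed.

Lemma flip_mulE n (M : 'M[C]_(d * d, n)) i j c :
  (F *m M) (mxtens_index (i, j)) c = M (mxtens_index (j, i)) c.
Proof.
rewrite mxE sum_mxtens (bigD1 j) //= (bigD1 i) //= flipE !eqxx mul1r.
rewrite !big1 ?addr0 // => [k ne|l ne].
  by apply: big1 => l _; rewrite flipE [j == _]eq_sym (negPf ne) andbF mul0r.
by rewrite flipE [i == _]eq_sym (negPf ne) mul0r.
Qed.

Lemma mul_flipE n (M : 'M[C]_(n, d * d)) r i j :
  (M *m F) r (mxtens_index (i, j)) = M r (mxtens_index (j, i)).
Proof.
rewrite mxE sum_mxtens (bigD1 j) //= (bigD1 i) //= flipE !eqxx mulr1.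
rewrite !big1 ?addr0 // => [k ne|l ne].
  by apply: big1 => l _; rewrite flipE (negPf ne) mulr0.
by rewrite flipE (negPf ne) andbF mulr0.
Qed.

Lemma flipK : F *m F = 1%:M.
Proof.
apply: tensmx_matrixP => i j k l; rewrite flip_mulE flipE mxE.
by rewrite (can_eq (@mxtens_indexK d d)) xpair_eqE andbC.
Qed.

Lemma adj_flip : F^t* = F.
Proof.
apply: tensmx_matrixP => i j k l; rewrite !mxE !flipE /= conjC_nat.
by rewrite andbC [k == _]eq_sym [l == _]eq_sym.
Qed.

Lemma flip_tens (A B : 'M[C]_d) : F *m (A *t B) = (B *t A) *m F.
Proof.
by apply: tensmx_matrixP => i j k l; rewrite flip_mulE mul_flipE !tensmxE mulrC.
Qed.

Lemma flip_tvec (A : 'M[C]_d) : F *m tvec A = tvec A^T.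
Proof.
apply/matrixP => r c; case: (mxtens_indexP r) => i j.
by rewrite flip_mulE !tvecE mxE.
Qed.

Lemma tens_tvec (A B M : 'M[C]_d) : (A *t B) *m tvec M = tvec (A *m M *m B^T).
Proof.
apply/matrixP => r c; case: (mxtens_indexP r) => i j.
rewrite tvecE mxE sum_mxtens exchange_big mxE; apply: eq_bigr => l _.
rewrite mxE mulr_suml; apply: eq_bigr => k _.
by rewrite tensmxE tvecE mxE mulrAC.
Qed.

Lemma adj_tvec_mul (A B : 'M[C]_d) :
  (tvec A)^t* *m tvec B = (\tr (B *m A^t*))%:M.
Proof.
apply/matrixP => i j; rewrite !ord1 !mxE eqxx mulr1n sum_mxtens.
apply: eq_bigr => k _; rewrite mxE; apply: eq_bigr => l _.
by rewrite !mxE mxtens_indexK mulrC.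
Qed.

(** The swap trick, which produces the term tr X^2 in the trace of the completion. *)
Lemma mxtrace_flip_tens (A B : 'M[C]_d) : \tr (F *m (A *t B)) = \tr (A *m B).
Proof.
rewrite /mxtrace sum_mxtens exchange_big; apply: eq_bigr => i _; rewrite mxE.
by apply: eq_bigr => j _; rewrite flip_mulE tensmxE.
Qed.

Lemma flip_sub1_sqr : (1%:M - F) *m (1%:M - F) = 2 *: (1%:M - F).
Proof.
rewrite mulmxBl !mulmxBr flipK !mulmx1 !mul1mx -[F - 1%:M]opprB opprK.
by rewrite -mulr2n scaler_nat.
Qed.

Lemma asym_projK : Pi *m Pi = Pi.
Proof.
rewrite /asym_proj -scalemxAl -scalemxAr flip_sub1_sqr !scalerA.
by rewrite mulfVK ?pnatr_eq0.
Qed.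

Lemma adj_asym_proj : Pi^t* = Pi.
Proof. by rewrite /asym_proj adjmxZ adjmxB adjmx1 adj_flip fmorphV rmorph_nat. Qed.

Lemma asym_projP n (M : 'M[C]_(d * d, n)) : Pi *m M = M <-> F *m M = - M.
Proof.
rewrite /asym_proj -scalemxAl mulmxBl mul1mx; split=> [PM|->].
  have : 2 *: (2^-1 *: (M - F *m M)) = 2 *: M by rewrite PM.
  rewrite scalerA mulfV ?pnatr_eq0 // scale1r scaler_nat mulr2n.
  by move=> /addrI E; rewrite -[in RHS]E opprK.
by rewrite opprK -mulr2n -[M *+ 2]scaler_nat scalerA mulVf ?pnatr_eq0 // scale1r.
Qed.

Lemma partial_transposeE (s : 'M[C]_(d * d)) i j k l :
  PT s (mxtens_index (i, j)) (mxtens_index (k, l)) =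
  s (mxtens_index (i, l)) (mxtens_index (k, j)).
Proof. by rewrite mxE !mxtens_indexK. Qed.

Lemma partial_transposeK (s : 'M[C]_(d * d)) : PT (PT s) = s.
Proof. by apply: tensmx_matrixP => i j k l; rewrite !partial_transposeE. Qed.

Lemma partial_transpose_linear : linear PT.
Proof. by move=> a A B; apply/matrixP => r c; rewrite !mxE. Qed.

HB.instance Definition _ :=
  GRing.isLinear.Build C 'M[C]_(d * d) 'M[C]_(d * d) _ (@partial_transpose R d)
    partial_transpose_linear.

Lemma partial_transpose_tens (A B : 'M[C]_d) : PT (A *t B) = A *t B^T.
Proof.
by apply: tensmx_matrixP => i j k l; rewrite partial_transposeE !tensmxE mxE.
Qed.

(** The entry at (i j, k l) is A_il times the conjugate of B_kj, that is, the entry of A (x) B^* at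
    (i j, l k); [F] on the right swaps l and k. *)
Lemma partial_transpose_tvec (A B : 'M[C]_d) :
  PT (tvec A *m (tvec B)^t*) = (A *t B^t*) *m F.
Proof.
apply: tensmx_matrixP => i j k l.
by rewrite partial_transposeE mul_flipE tensmxE mxE big_ord1 !mxE !mxtens_indexK.
Qed.

Lemma partial_transpose_tensF (A B : 'M[C]_d) :
  PT ((A *t B^t*) *m F) = tvec A *m (tvec B)^t*.
Proof. by rewrite -partial_transpose_tvec partial_transposeK. Qed.

(** Both sides are the same fourfold sum with j and l renamed. This moves the partial transpose from
    a PPT state to the witness. *)
Lemma mxtrace_partial_transpose (A B : 'M[C]_(d * d)) :
  \tr (PT A *m B) = \tr (A *m PT B).
Proof.
transitivity (\sum_i \sum_j \sum_k \sum_l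
    A (mxtens_index (i, l)) (mxtens_index (k, j)) *
    B (mxtens_index (k, l)) (mxtens_index (i, j))).
  rewrite /mxtrace sum_mxtens; do 2!apply: eq_bigr => ? _.
  by rewrite mxE sum_mxtens; do 2!apply: eq_bigr => ? _; rewrite partial_transposeE.
rewrite /mxtrace sum_mxtens; apply: eq_bigr => i _.
transitivity (\sum_j \sum_k \sum_l
    A (mxtens_index (i, j)) (mxtens_index (k, l)) *
    B (mxtens_index (k, j)) (mxtens_index (i, l))); last first.
  apply: eq_bigr => j _.
  by rewrite mxE sum_mxtens; do 2!apply: eq_bigr => ? _; rewrite partial_transposeE.
rewrite exchange_big [RHS]exchange_big; apply: eq_bigr => k _.
by rewrite exchange_big.
Qed.

End Flip.

(** * The PPT completion of an antisymmetric state *)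

Section NormalForm.
Variables (C : numClosedFieldType) (d : nat).

(** Antisymmetry makes B^* B the complex conjugate of B B^*, hence equal to the real matrix D as
    well. So D B = B B^* B = B D, and [B] only links equal eigenvalues. *)
Lemma antisym_diag_gram (B : 'M[C]_d) (D : 'rV[C]_d) :
    B^T = - B -> B *m B^t* = diag_mx D -> (forall i, 0 <= D 0 i) ->
  forall i j, B i j != 0 -> D 0 i = D 0 j /\ D 0 i != 0.
Proof.
move=> Basym BB D0 i j Bij.
have adjB : B^t* = - map_mx Num.conj B by rewrite Basym map_mxN.
have BB' : B^t* *m B = diag_mx D.
  have -> : diag_mx D = map_mx Num.conj (diag_mx D).
    rewrite map_diag_mx; congr diag_mx; apply/rowP => k.
    by rewrite mxE /= geC0_conj.
  rewrite -BB adjB mulNmx mulmxN map_mxN map_mxM; congr (- (_ *m _)).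
  by rewrite -map_mx_comp map_mx_id // => x /=; rewrite conjCK.
split.
  have : (diag_mx D *m B) i j = (B *m diag_mx D) i j by rewrite -{1}BB -BB' mulmxA.
  by rewrite mul_diag_mx mul_mx_diag !mxE [RHS]mulrC => /(mulIf Bij).
(* D_i is the squared norm of row i of [B], which contains B_ij. *)
have /matrixP/(_ i i) := BB; rewrite !mxE eqxx mulr1n => <-.
rewrite psumr_neq0 => [|k _]; last by rewrite !mxE mul_conjC_ge0.
by apply/hasP; exists j; rewrite ?mem_index_enum //= !mxE mul_conjC_gt0.
Qed.

(* With A A^* = U^* D U, the matrix B = U A U^T commutes with D since B is
   antisymmetric and B B^* = D; hence B = D^(1/4) W D^(1/4) with W = D^(-1/2) B
   a partial isometry.  The junk value 0^-1 = 0 makes D^(-1/2) the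
   pseudo-inverse. *)
Lemma antisym_factor (A U : 'M[C]_d) (D : 'rV[C]_d) :
    A^T = - A -> U \is unitarymx -> (forall i, 0 <= D 0 i) ->
    A *m A^t* = U^t* *m diag_mx D *m U ->
  exists S W : 'M[C]_d, [/\ A = S *m W *m S^T, W *m W^t* *m W = W &
    (S *m S^t*) *m (S *m S^t*) = A *m A^t*].
Proof.
move=> Aasym Uu D0 AA.
have UU := unitarymxP Uu.
have UU' : U^t* *m U = 1%:M.
  by rewrite -(invmx_unitary Uu) mulVmx // unitarymx_unit.
have UTT : U^T *m (U^T)^t* = 1%:M.
  have /unitarymxP // : U^T \is unitarymx by rewrite trmx_unitary.
(* Using U^T on the right instead of U^* preserves antisymmetry, and still diagonalises the Gram
   matrix. *)
have [B Bdef] : exists B, B = U *m A *m U^T by eexists.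
have Basym : B^T = - B.
  by rewrite Bdef !trmx_mul trmxK Aasym mulNmx mulmxN mulmxA.
have BB : B *m B^t* = diag_mx D.
  rewrite Bdef !adjmxM !mulmxA -(mulmxA _ U^T) UTT mulmx1 -(mulmxA U) AA !mulmxA UU.
  by rewrite mul1mx -mulmxA UU mulmx1.
have Bgram := antisym_diag_gram Basym BB D0.
have [r rE] : exists r : 'rV[C]_d, forall i, r 0 i = sqrtC (D 0 i).
  by exists (map_mx sqrtC D) => i; rewrite mxE.
have [s sE] : exists s : 'rV[C]_d, forall i, s 0 i = sqrtC (r 0 i).
  by exists (map_mx sqrtC r) => i; rewrite mxE.
have r0 i : 0 <= r 0 i by rewrite rE sqrtC_ge0.
have ss i : s 0 i * s 0 i = r 0 i by rewrite sE -expr2 sqrtCK.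
have rr i : r 0 i * r 0 i = D 0 i by rewrite rE -expr2 sqrtCK.
have [W WE] : exists W : 'M[C]_d, forall i j, W i j = B i j / r 0 i.
  by exists (\matrix_(i, j) (B i j / r 0 i)) => i j; rewrite mxE.
have sWs : diag_mx s *m W *m diag_mx s = B.
  apply/matrixP => i j; rewrite mul_mx_diag mxE mul_diag_mx mxE WE.
  have [->|Bij] := eqVneq (B i j) 0; first by rewrite mul0r mulr0 mul0r.
  have [Dij Di] := Bgram _ _ Bij.
  (* Since B_ij links equal eigenvalues, the product is s_i^2 B_ij / r_i = B_ij. *)
  have -> : s 0 j = s 0 i by rewrite !sE !rE Dij.
  by rewrite mulrAC ss mulrCA mulfV ?mulr1 // rE sqrtC_eq0.
exists (U^t* *m diag_mx s), W.
have ST : (U^t* *m diag_mx s)^T = diag_mx s *m (U^T)^t*.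
  by rewrite trmx_mul tr_diag_mx map_trmx.
have SS : U^t* *m diag_mx s *m (U^t* *m diag_mx s)^t* = U^t* *m diag_mx r *m U.
  rewrite adjmxM trmxCK tr_diag_mx map_diag_mx !mulmxA; congr (_ *m _).
  rewrite -mulmxA mulmx_diag; congr (_ *m diag_mx _); apply/rowP => i.
  by rewrite mxE mxE [X in _ * X]geC0_conj ?ss // sE sqrtC_ge0.
split.
- rewrite ST !mulmxA -(mulmxA (U^t*)) -(mulmxA (U^t*)) sWs Bdef !mulmxA UU' mul1mx.
  by rewrite -mulmxA UTT mulmx1.
- apply/matrixP => i j.
  (* W W^* is the projector onto the support of D; it fixes [W] because a row of [B] with a nonzero
     entry has a nonzero eigenvalue. *)
  have WW k l : (W *m W^t*) k l = (D 0 k != 0)%:R * (k == l)%:R.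
    transitivity ((B *m B^t*) k l / r 0 k / r 0 l).
      rewrite !mxE !mulr_suml; apply: eq_bigr => m _.
      rewrite mxE mxE mxE mxE !WE rmorphM fmorphV /= [(r 0 l)^*]geC0_conj //; ring.
    rewrite BB mxE; have [->|kl] := eqVneq k l; last by rewrite !mul0r mulr0.
    rewrite mulr1n mulr1 -mulrA -invfM rr.
    by have [->|D1] := eqVneq (D 0 l) 0; rewrite ?mul0r // mulfV.
  rewrite mxE (bigD1 i) //= big1 ?addr0 => [|k ki].
    rewrite WW eqxx mulr1 !WE.
    have [->|Bij] := eqVneq (B i j) 0; first by rewrite mul0r mulr0.
    by have [_ ->] := Bgram _ _ Bij; rewrite mul1r.
  by rewrite WW [i == k]eq_sym (negPf ki) mulr0 mul0r.
- rewrite SS !mulmxA -(mulmxA _ U) UU mulmx1 AA -(mulmxA (U^t*)) mulmx_diag.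
  by congr (_ *m diag_mx _ *m _); apply/rowP => i; rewrite mxE rr.
Qed.

End NormalForm.

(** Meant for A = 1, B = G and D = G^2, where it splits 1 + G into half of (1 + G)^2 and half of 1 -
    G^2. *)
Lemma add_half_mx (K : numFieldType) m n (A B D : 'M[K]_(m, n)) :
  A + B = 2^-1 *: (A + B + (B + D)) + 2^-1 *: (A - D).
Proof. by apply/matrixP => i j; rewrite !mxE; field; rewrite ?pnatr_eq0. Qed.

Section Completion.
Variables (R : realType) (d : nat).
Local Notation C := R[i]%C.
Local Notation F := (flip R d).
Local Notation Pi := (asym_proj R d).
Local Notation PT := (@partial_transpose R d).

Lemma swap_tens_adj (W : 'M[C]_d) :
  ((W *t W^t*) *m F)^t* = (W *t W^t*) *m F.
Proof. by rewrite adjmxM adj_flip adjmx_tens trmxCK flip_tens. Qed.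

Lemma swap_tens_sqr (W : 'M[C]_d) :
  (W *t W^t*) *m F *m ((W *t W^t*) *m F) = (W *m W^t*) *t (W^t* *m W).
Proof.
rewrite mulmxA -(mulmxA _ F) flip_tens mulmxA tensmx_mul -mulmxA flipK.
by rewrite mulmx1.
Qed.

(** [G] is self-adjoint and, [W] being a partial isometry, its square [Q] is a projector. So G has
    spectrum in {-1, 0, 1}, and 1 + G is half of (1 + G)^2 plus half of the projector 1 - Q. *)
Lemma swap_tens_psd (W : 'M[C]_d) :
  W *m W^t* *m W = W -> psd (1%:M + (W *t W^t*) *m F).
Proof.
move=> WWW; set G := (W *t W^t*) *m F; pose Q := (W *m W^t*) *t (W^t* *m W).
have hG : G^t* = G by exact: swap_tens_adj.
have QQ : Q *m Q = Q.
  rewrite tensmx_mul; congr (_ *t _); first by rewrite mulmxA WWW.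
  by rewrite -mulmxA [W *m _]mulmxA WWW.
have hQ : Q^t* = Q by rewrite adjmx_tens !adjmxM trmxCK.
have -> : 1%:M + G = 2^-1 *: ((1%:M + G) *m (1%:M + G)^t*) + 2^-1 *: (1%:M - Q).
  rewrite adjmxD adjmx1 hG mulmxDl !mulmxDr !mulmx1 mul1mx swap_tens_sqr -/Q.
  exact: add_half_mx.
have h0 : 0 <= 2^-1 :> C by rewrite invr_ge0 ler0n.
apply: psdD; apply: psdZ => //; first exact: psd_gram.
apply: psd_proj; first by rewrite adjmxB adjmx1 hQ.
by rewrite mulmxBl !mulmxBr !mulmx1 mul1mx QQ subrr subr0.
Qed.

Lemma trmx_adjC m n (S : 'M[C]_(m, n)) : (S^T)^t* = (S^t*)^T.
Proof. by rewrite map_trmx. Qed.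

(** This is [swap_tens_psd] conjugated by K = S (x) conj S: K K^* is X (x) X^T, and moving K^*
    through [F] exchanges its factors, which turns W (x) W^* into A (x) A^*. *)
Lemma factor_psd (S W : 'M[C]_d) (A := S *m W *m S^T) (X := S *m S^t*) :
  W *m W^t* *m W = W -> psd (X *t X^T + (A *t A^t*) *m F).
Proof.
move=> WWW; pose K := S *t (S^t*)^T.
have adjK : K^t* = S^t* *t S^T by rewrite adjmx_tens trmx_adjC trmxCK.
suff -> : X *t X^T + (A *t A^t*) *m F = K *m (1%:M + (W *t W^t*) *m F) *m K^t*.
  exact/psd_congr/swap_tens_psd.
rewrite mulmxDr mulmxDl mulmx1 adjK tensmx_mul -trmx_mul; congr (_ + _).
rewrite -!mulmxA flip_tens !mulmxA !tensmx_mul; congr (_ *t _ *m _).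
by rewrite !adjmxM trmx_adjC !mulmxA.
Qed.

(** The case of one unnormalised pure component. All four conclusions are additive, so completions
    of the components of a mixed state can be summed. *)
Lemma sym_completion (psi : 'cV[C]_(d * d)) : F *m psi = - psi ->
  exists tau : 'M[C]_(d * d), [/\ psd tau, F *m tau = tau,
    psd (PT (psi *m psi^t* + tau)) &
    \tr tau <= (d%:R + 1) * \tr (psi *m psi^t*)].
Proof.
move=> Fpsi.
pose A : 'M[C]_d := \matrix_(i, j) psi (mxtens_index (i, j)) 0.
have psiE : psi = tvec A.
  apply/matrixP=> r c; case: (mxtens_indexP r) => i j.
  by rewrite tvecE ord1 mxE.
have Aasym : A^T = - A.
  by apply/matrixP=> i j; rewrite !mxE -flip_mulE Fpsi mxE.
have [U [D [Uu AA D0]]] := psd_spectral (psd_gram A).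
have [S [W [Adef WWW XX]]] := antisym_factor Aasym Uu D0 AA.
pose X := S *m S^t*.
have hX : X^t* = X by rewrite adjmxM trmxCK.
have trpsi : \tr (psi *m psi^t*) = \tr (X *m X).
  by rewrite mxtrace_mulC psiE adj_tvec_mul XX /mxtrace big_ord1 mxE eqxx.
(* The summand X (x) X compensates the negative part of the transposed projector; F (X (x) X) makes
   the sum symmetric and only contributes a positive term after transposition. *)
exists ((1%:M + F) *m (X *t X)); split.
- pose T := S *t S.
  have XT : X *t X = T *m T^t* by rewrite adjmx_tens tensmx_mul.
  (* As [F] commutes with X (x) X and (1 + F)^2 = 2 (1 + F), the completion is half a Gram
     matrix. *)
  have FT : F *m (X *t X) = (X *t X) *m F by exact: flip_tens.
  have -> : (1%:M + F) *m (X *t X) =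
      2^-1 *: (((1%:M + F) *m T) *m ((1%:M + F) *m T)^t*).
    rewrite adjmxM adjmxD adjmx1 adj_flip !mulmxA -(mulmxA _ T) -XT.
    rewrite mulmxDl mul1mx FT mulmxDr mulmx1 mulmxDl -(mulmxA _ F) flipK mulmx1.
    rewrite [X in _ = _ *: (_ + X)]addrC -mulr2n -[(_ + _) *+ 2]scaler_nat.
    by rewrite scalerA mulVf ?pnatr_eq0 // scale1r.
  by apply: psdZ; [rewrite invr_ge0 ler0n | exact: psd_gram].
- by rewrite mulmxA mulmxDr mulmx1 flipK addrC.
(* The transpose is (A (x) A^* ) F + X (x) X^T + |X><X|; [factor_psd] handles the first two terms
   together. *)
- rewrite mulmxDl mul1mx flip_tens !linearD /= {1 2}psiE partial_transpose_tvec.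
  rewrite partial_transpose_tens -{4}hX partial_transpose_tensF addrA.
  apply: psdD; last exact: psd_gram.
  by rewrite addrC Adef; exact: factor_psd.
rewrite mulmxDl mul1mx mxtraceD mxtrace_tens mxtrace_flip_tens trpsi.
by rewrite mulrDl mul1r lerD2r -expr2 mxtrace_sqr_le.
Qed.

Lemma mulmx_adj_cols n m (M : 'M[C]_(n, m)) :
  M *m M^t* = \sum_k col k M *m (col k M)^t*.
Proof.
apply/matrixP => i j; rewrite mxE summxE; apply: eq_bigr => k _.
by rewrite [RHS]mxE big_ord1 !mxE.
Qed.

(** Before normalisation the antisymmetric part is [rho] with trace 1, and the symmetric part has
    trace at most d + 1; dividing by the total trace leaves weight at least 1 / (d + 2). *)
Lemma antisym_state_completion (rho : 'M[C]_(d * d)) : antisym_state rho ->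
  exists2 sigma, PPT_state sigma /\
      Pi *m sigma *m Pi = \tr (Pi *m sigma) *: rho &
    (d%:R + 2)^-1 <= \tr (Pi *m sigma).
Proof.
case=> -[rho_psd tr_rho] rho_asym.
have [L rhoL] := psd_gramP rho_psd.
(* From rho = L L^* and Pi rho Pi = rho, the columns of Pi L give an ensemble of antisymmetric
   vectors for [rho]. *)
pose M := Pi *m L; pose psi k := col k M.
have rhoM : rho = \sum_k psi k *m (psi k)^t*.
  rewrite -mulmx_adj_cols adjmxM adj_asym_proj -[LHS]rho_asym rhoL.
  by rewrite !mulmxA.
have Fpsi k : F *m psi k = - psi k.
  by apply/asym_projP; rewrite /psi colE /M !mulmxA asym_projK.
have [tau tauP] := fin_all_exists (fun k => sym_completion (Fpsi k)).
pose T := \sum_k tau k; pose s := rho + T; pose t := \tr s.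
have PiT : Pi *m T = 0.
  rewrite mulmx_sumr big1 // => k _; have [_ Ft _ _] := tauP k.
  by rewrite /asym_proj -scalemxAl mulmxBl mul1mx Ft subrr scaler0.
have Pirho : Pi *m rho = rho by rewrite -{1}rho_asym !mulmxA asym_projK.
have rhoPi : rho *m Pi = rho by rewrite -{1}rho_asym -mulmxA asym_projK.
have Pis : Pi *m s = rho by rewrite mulmxDr PiT addr0.
have psdT : psd T by apply: psd_sum => k; have [] := tauP k.
have t_ge1 : 1 <= t by rewrite /t mxtraceD tr_rho lerDl psd_mxtrace_ge0.
have t_gt0 : 0 < t by rewrite (lt_le_trans ltr01).
have t_le : t <= d%:R + 2.
  rewrite /t mxtraceD tr_rho -[2]/(1 + 1) addrCA lerD2l -[leRHS]mulr1.
  rewrite -[X in _ * X]tr_rho.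
  rewrite [in leRHS]rhoM !raddf_sum /= mulr_sumr ler_sum // => k _.
  by have [] := tauP k.
have psds : psd s by exact: psdD.
have psdPTs : psd (PT s).
  rewrite /s rhoM -big_split linear_sum; apply: psd_sum => k /=.
  by have [] := tauP k.
have ti : 0 <= t^-1 by rewrite invr_ge0 ltW.
exists (t^-1 *: s).
  rewrite -[Pi *m (_ *: s)]scalemxAr Pis -[(_ *: rho) *m Pi]scalemxAl rhoPi.
  rewrite mxtraceZ tr_rho mulr1; split; last by [].
  split; last by rewrite linearZ; exact: psdZ.
  by split; [exact: psdZ | rewrite mxtraceZ mulVf // gt_eqF].
rewrite -[Pi *m (_ *: s)]scalemxAr Pis mxtraceZ tr_rho mulr1 lef_pV2 // posrE.
by rewrite (lt_le_trans t_gt0).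
Qed.

End Completion.

(** * The bound for antisymmetric maximally entangled states *)

Lemma adj_absorb (K : numClosedFieldType) n (P Q : 'M[K]_n) :
  P^t* = P -> Q^t* = Q -> P *m Q = Q -> Q *m P = Q.
Proof. by move=> hP hQ PQ; rewrite -[RHS]hQ -[in RHS]PQ adjmxM hP hQ. Qed.

(** The factor 1 / d normalises |A> for unitary [A], whose squared norm is then tr (A A^* ) = d. *)
Definition max_entangled (R : realType) d (A : 'M[R[i]%C]_d) : 'M[R[i]%C]_(d * d) :=
  d%:R^-1 *: (tvec A *m (tvec A)^t*).

Section UpperBound.
Variables (R : realType) (d : nat).
Local Notation C := R[i]%C.
Local Notation F := (flip R d).
Local Notation Pi := (asym_proj R d).
Local Notation PT := (@partial_transpose R d).
Hypothesis d_gt0 : (0 < d)%N.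

Let dN0 : d%:R != 0 :> C. Proof. by rewrite pnatr_eq0 -lt0n. Qed.

Let mulV2 : 2^-1 * 2 = 1 :> C. Proof. by rewrite mulVf // pnatr_eq0. Qed.

Lemma tvec_norm (A : 'M[C]_d) : A *m A^t* = 1%:M -> (tvec A)^t* *m tvec A = d%:R%:M.
Proof. by move=> AA; rewrite adj_tvec_mul AA mxtrace1. Qed.

Lemma max_entangled_adj (A : 'M[C]_d) : (max_entangled A)^t* = max_entangled A.
Proof. by rewrite /max_entangled adjmxZ adjmxM trmxCK fmorphV rmorph_nat. Qed.

Lemma max_entangled_sqr (A : 'M[C]_d) : A *m A^t* = 1%:M ->
  max_entangled A *m max_entangled A = max_entangled A.
Proof.
move=> AA; rewrite /max_entangled -scalemxAl -scalemxAr mulmxA.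
rewrite -(mulmxA _ _ (tvec A)) (tvec_norm AA) mul_mx_scalar -scalemxAl.
by rewrite [X in _ *: X]scalerA (mulVf dN0) scale1r.
Qed.

Lemma mxtrace_max_entangled (A : 'M[C]_d) : A *m A^t* = 1%:M ->
  \tr (max_entangled A) = 1.
Proof.
move=> AA; rewrite mxtraceZ mxtrace_mulC (tvec_norm AA) mxtrace_scalar mulr1n.
exact: mulVf.
Qed.

Section AntisymmetricUnitary.
Variable W : 'M[C]_d.
Hypothesis W_unitary : W *m W^t* = 1%:M.
Hypothesis W_asym : W^T = - W.

Local Notation rho := (max_entangled W).
Local Notation Phi := (max_entangled (1%:M : 'M[C]_d)).
Local Notation G := ((W *t W^t*) *m F).

Lemma asym_proj_max_entangled : Pi *m rho = rho.
Proof.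
have PW : Pi *m tvec W = tvec W.
  apply/asym_projP; rewrite flip_tvec W_asym.
  by apply/matrixP => i j; rewrite !mxE.
by rewrite /max_entangled -scalemxAr mulmxA PW.
Qed.

Lemma max_entangled_asym_proj : rho *m Pi = rho.
Proof.
exact: adj_absorb (adj_asym_proj R d) (max_entangled_adj W) asym_proj_max_entangled.
Qed.

Lemma max_entangled_antisym_state : antisym_state rho.
Proof.
split; last by rewrite asym_proj_max_entangled max_entangled_asym_proj.
split; last exact: mxtrace_max_entangled.
by apply: psd_proj; [exact: max_entangled_adj | exact: max_entangled_sqr].
Qed.

(* The kernel of the partial transpose of the optimal sigma. *)
Definition ppt_witness := 2^-1 *: (1%:M - G) - Phi.

(** [P] projects onto the -1 eigenspace of the involution [G]. That eigenspace contains |1>, so Phi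
    lies below [P] and the difference is again a projector. *)
Lemma ppt_witness_psd : psd ppt_witness.
Proof.
have GG : G *m G = 1%:M.
  by rewrite swap_tens_sqr (mulmx1C W_unitary) W_unitary tensmx1.
have hG : G^t* = G by exact: swap_tens_adj.
(* Antisymmetry enters here: conj W = - W^*, so (W (x) W^* ) |1> = |W conj W> = - |W W^*> = -
   |1>. *)
have Gphi : G *m tvec 1%:M = - tvec 1%:M.
  rewrite -mulmxA flip_tvec trmx1 tens_tvec mulmx1 -trmx_adjC W_asym.
  rewrite -scaleN1r adjmxZ rmorphN rmorph1 scaleN1r mulmxN W_unitary.
  by apply/matrixP => i j; rewrite !mxE.
have [P PE] : exists P, P = 2^-1 *: (1%:M - G) by eexists.
have hP : P^t* = P.
  by rewrite PE adjmxZ adjmxB adjmx1 hG fmorphV rmorph_nat.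
have PP : P *m P = P.
  rewrite PE -scalemxAl -scalemxAr mulmxBl !mulmxBr GG !mulmx1 mul1mx.
  rewrite -[G - 1%:M]opprB opprK -mulr2n -[(_ - _) *+ 2]scaler_nat.
  by rewrite [X in _ *: X]scalerA mulV2 scale1r.
have Pphi : P *m tvec 1%:M = tvec 1%:M.
  rewrite PE -scalemxAl mulmxBl mul1mx Gphi opprK.
  by rewrite -mulr2n -[tvec _ *+ 2]scaler_nat scalerA mulV2 scale1r.
have PQ : P *m Phi = Phi by rewrite /max_entangled -scalemxAr mulmxA Pphi.
have QP : Phi *m P = Phi by exact: adj_absorb hP (max_entangled_adj _) PQ.
have QQ : Phi *m Phi = Phi by apply: max_entangled_sqr; rewrite adjmx1 mulmx1.
rewrite /ppt_witness -PE; apply: psd_proj.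
  by rewrite adjmxB hP max_entangled_adj.
by rewrite mulmxBl !mulmxBr PP PQ QP QQ subrr subr0.
Qed.

(** Transposition sends [G] to d rho and Phi to F / d, so pairing the result with sigma only
    involves tr sigma, tr (sigma rho) and tr (sigma F). *)
Lemma partial_transpose_witness :
  PT ppt_witness = 2^-1 *: (1%:M - d%:R *: rho) - d%:R^-1 *: F.
Proof.
rewrite /ppt_witness /max_entangled linearB !linearZ /= linearB /=.
rewrite partial_transpose_tensF partial_transpose_tvec adjmx1 tensmx1 mul1mx.
rewrite [d%:R *: _]scalerA (mulfV dN0) scale1r.
by rewrite -[in PT 1%:M](tensmx1 C d d) partial_transpose_tens trmx1 tensmx1.
Qed.

Lemma flip_asym_proj : F = 1%:M - 2 *: Pi.
Proof.
rewrite /asym_proj scalerA mulrC mulV2 scale1r.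
by rewrite opprB addrCA subrr addr0.
Qed.

Lemma max_entangled_weight_le (sigma : 'M[C]_(d * d)) : (2 < d)%N ->
  PPT_state sigma -> Pi *m sigma *m Pi = \tr (Pi *m sigma) *: rho ->
  \tr (Pi *m sigma) <= (d%:R + 2)^-1.
Proof.
move=> d_gt2 [[_ tr_sigma] psd_PT] asym_sigma; set t := \tr (Pi *m sigma).
(* As rho = Pi rho Pi, only the antisymmetric block t rho of sigma contributes, and tr rho^2 = 1. *)
have tr_rho : \tr (sigma *m rho) = t.
  rewrite -[in LHS]asym_proj_max_entangled -[in LHS]max_entangled_asym_proj.
  rewrite !mulmxA mxtrace_mulC !mulmxA asym_sigma -scalemxAl mxtraceZ.
  by rewrite (max_entangled_sqr W_unitary) (mxtrace_max_entangled W_unitary) mulr1.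
have tr_F : \tr (sigma *m F) = 1 - 2 * t.
  rewrite flip_asym_proj mulmxBr mulmx1 -[sigma *m _]scalemxAr raddfB /= mxtraceZ.
  by rewrite tr_sigma mxtrace_mulC.
have [L KL] := psd_gramP ppt_witness_psd.
(* With the witness written L L^*, this is the trace of L^* PT(sigma) L. *)
have : 0 <= \tr (PT sigma *m ppt_witness).
  rewrite KL mulmxA mxtrace_mulC mulmxA -{2}(trmxCK L).
  by apply: psd_mxtrace_ge0; exact: psd_congr.
rewrite mxtrace_partial_transpose partial_transpose_witness.
move: tr_rho; move: rho => r tr_rho.
rewrite mulmxBr -!scalemxAr mulmxBr mulmx1 -scalemxAr.
rewrite !raddfB /= !mxtraceZ tr_rho tr_F tr_sigma => t_ge.
have d2 : 0 < d%:R - 2 :> C by rewrite subr_gt0 ltr_nat.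
have dd2 : 0 < d%:R + 2 :> C by rewrite -natrD ltr0n addn2.
rewrite -[leRHS]mul1r ler_pdivlMr // -subr_ge0 -(pmulr_rge0 _ d2).
(* Multiplying the inequality by 2 d gives d - 2 - (d^2 - 4) t, from which the positive factor d - 2
   can be cancelled. *)
have -> : (d%:R - 2) * (1 - t * (d%:R + 2)) =
    2 * d%:R * (2^-1 * 1 - 2^-1 * (d%:R * t) - d%:R^-1 * (1 - 2 * t)).
  by field; rewrite dN0.
by rewrite mulr_ge0 // mulr_ge0 ?ler0n.
Qed.

End AntisymmetricUnitary.

End UpperBound.

(** * The symplectic form and its maximally entangled state *)

Section Omega.
Variables (R : realType) (d : nat).
Local Notation C := R[i]%C.
Hypothesis d_even : ~~ odd d.

Lemma Omega_tr : (Omega R d)^T = - Omega R d.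
Proof. by apply/matrixP => i j; rewrite !mxE opprB. Qed.

Lemma Omega_adj : (Omega R d)^t* = - Omega R d.
Proof.
by apply/matrixP => i j; rewrite !mxE rmorphB !rmorph_nat opprB.
Qed.

(** Omega is a signed permutation matrix: row i has the single entry [s i] in column [p i], where
    [p] is the involution shifting by d / 2 and reverses the sign [s]. *)
Lemma Omega_sqr : Omega R d *m Omega R d = - 1%:M.
Proof.
pose h := d./2.
have dE : d = (h + h)%N by rewrite addnn; lia.
have pP (i : 'I_d) : ((if i < h then i + h else i - h) < d)%N.
  by have := ltn_ord i; case: ifP; lia.
pose p i := Ordinal (pP i).
pose s (i : 'I_d) : C := if (i < h)%N then 1 else -1.
have OmegaE i k : Omega R d i k = s i * (k == p i)%:R.
  rewrite mxE -!/h -val_eqE /= /s; have := ltn_ord i; have := ltn_ord k.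
  case: ifP => ih kd id_.
    have -> : ((i : nat) == (k + h)%N) = false by apply/eqP; lia.
    by rewrite subr0 mul1r.
  have -> : ((k : nat) == (i + h)%N) = false by apply/eqP; lia.
  rewrite sub0r mulN1r; congr (- (_ : bool)%:R).
  by apply/eqP/eqP; lia.
apply/matrixP => i j; rewrite mxE (bigD1 (p i)) //= big1 ?addr0 => [|k ki].
  have ppi : p (p i) = i.
    by apply: val_inj => /=; have := ltn_ord i; case: (ltnP i h); case: ifP; lia.
  have sp : s (p i) = - s i.
    rewrite /s /=; have := ltn_ord i; case: (ltnP i h) => ih id_.
      by rewrite ifF //; lia.
    by rewrite ifT ?opprK //; lia.
  rewrite !OmegaE eqxx mulr1 ppi sp !mxE [j == i]eq_sym mulNr mulrN mulrA.
  by congr (- _); rewrite /s; case: ifP => _; rewrite ?mulrNN ?mul1r.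
by rewrite OmegaE (negPf ki) mulr0 mul0r.
Qed.

(** The minus sign comes from (1 (x) Omega) |1> = |Omega^T>. *)
Lemma omega_stateE : omega_state R d = max_entangled (- Omega R d).
Proof.
have omegaE : omega R d = (Num.sqrt (d%:R : R))^-1%:C%C *: tvec (- Omega R d).
  rewrite /omega -scalemxAr; congr (_ *: _).
  have -> : \sum_(j < d) ket2 R j j = tvec 1%:M.
    apply/matrixP => r c; case: (mxtens_indexP r) => i j; rewrite tvecE ord1.
    rewrite summxE mxE (bigD1 i) //= big1 ?addr0 => [|k ki].
      by rewrite mxE (can_eq (@mxtens_indexK d d)) xpair_eqE !eqxx andbT eq_sym.
    rewrite mxE (can_eq (@mxtens_indexK d d)) xpair_eqE.
    by rewrite [i == k]eq_sym (negPf ki).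
  by rewrite tens_tvec !mul1mx Omega_tr.
rewrite /omega_state /max_entangled omegaE adjmxZ -scalemxAl -scalemxAr.
rewrite scalerA; congr (_ *: _).
rewrite [X in _ * X]geC0_conj; last by rewrite ler0c invr_ge0 sqrtr_ge0.
by rewrite -rmorphM -invfM -expr2 sqr_sqrtr ?ler0n // fmorphV rmorph_nat.
Qed.

Lemma Omega_unitary : (- Omega R d) *m (- Omega R d)^t* = 1%:M.
Proof.
rewrite -scaleN1r adjmxZ rmorphN rmorph1 Omega_adj !scaleN1r opprK mulNmx.
by rewrite Omega_sqr opprK.
Qed.

Lemma Omega_asym : (- Omega R d)^T = - (- Omega R d).
Proof. by rewrite linearN /= Omega_tr. Qed.

End Omega.

(** * Compactness of the feasible set *)

Section Compactness.
Variable R : realType.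
Local Notation C := R[i]%C.
Local Notation "x %:C" := (real_complex R x).

(** A linear functional is a finite combination of the coordinate functions. *)
Lemma linear_rV_continuous m (f : 'rV[R]_m -> R) : scalar f -> continuous f.
Proof.
move=> f_lin.
have fD u v : f (u + v) = f u + f v.
  by have := f_lin 1 u v; rewrite !scale1r mul1r.
have f0 : f 0 = 0 by apply: (@addrI _ (f 0)); rewrite -fD !addr0.
have fZ a u : f (a *: u) = a * f u.
  by have := f_lin a u 0; rewrite !addr0 f0 addr0.
have -> : f = fun v => \sum_j v 0 j * f (delta_mx 0 j).
  apply: funext => v; rewrite {1}(row_sum_delta v) (big_morph f fD f0).
  by apply: eq_bigr => j _; rewrite fZ.
elim: (index_enum _) => [|j r IH].
  rewrite (_ : (fun _ => _) = cst 0); first exact: cst_continuous.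
  by apply: funext => v; rewrite big_nil.
rewrite (_ : (fun _ => _) = (fun v : 'rV[R]_m => v 0 j) \* cst (f (delta_mx 0 j)) +
    fun v => \sum_(i <- r) v 0 i * f (delta_mx 0 i)); last first.
  by apply: funext => v; rewrite big_cons.
move=> v; apply: continuousD; last exact: IH.
by apply: continuousM; [exact: coord_continuous | exact: cst_continuous].
Qed.

Variable n : nat.

(** Real coordinates, all real parts before all imaginary parts, so that compactness of boxes of
    real row vectors applies to complex matrices. *)
Definition mx_of_rV (v : 'rV[R]_(n * n + n * n)) : 'M[C]_n :=
  \matrix_(i, j) (Complex (v 0 (lshift _ (mxtens_index (i, j))))
                          (v 0 (rshift _ (mxtens_index (i, j))))).

Definition rV_of_mx (A : 'M[C]_n) : 'rV[R]_(n * n + n * n) :=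
  row_mx (\row_k complex.Re (A (mxtens_unindex k).1 (mxtens_unindex k).2))
         (\row_k complex.Im (A (mxtens_unindex k).1 (mxtens_unindex k).2)).

Lemma rV_of_mxK A : mx_of_rV (rV_of_mx A) = A.
Proof.
apply/matrixP => i j; rewrite mxE row_mxEl row_mxEr !mxE mxtens_indexK /=.
by case: (A i j).
Qed.

(** Only real scalars, because the adjoint is conjugate-linear. *)
Definition real_linear p (g : 'M[C]_n -> 'M[C]_p) :=
  forall (a : R) A B, g (a%:C *: A + B) = a%:C *: g A + g B.

Lemma mx_of_rV_linear a u v :
  mx_of_rV (a *: u + v) = a%:C *: mx_of_rV u + mx_of_rV v.
Proof.
apply/matrixP => i j; rewrite !mxE; apply/eqP.
by rewrite eq_complex /= !mul0r subr0 addr0 !eqxx.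
Qed.

Lemma linear_real_linear p (g : {linear 'M[C]_n -> 'M[C]_p}) : real_linear g.
Proof. by move=> a A B; rewrite linearP. Qed.

Lemma adj_real_linear p (g : 'M[C]_n -> 'M[C]_p) :
  real_linear g -> real_linear (fun A => (g A)^t*).
Proof.
move=> g_lin a A B; rewrite g_lin adjmxD adjmxZ; congr (_ *: _ + _).
by apply/CrealP; rewrite complex_real.
Qed.

Lemma closed_forall (T : topologicalType) (I : Type) (P : I -> T -> Prop) :
  (forall i, closed [set v | P i v]) -> closed [set v | forall i, P i v].
Proof.
move=> clP; have -> : [set v | forall i, P i v] = \bigcap_i [set v | P i v].
  by apply/seteqP; split=> [v Pv i _|v Pv i]; [exact: Pv | exact: (Pv i)].
by apply: closed_bigI => i _; exact: clP.
Qed.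

Lemma closed_entry p (g : 'M[C]_n -> 'M[C]_p) i j (D E : set R) :
    real_linear g -> closed D -> closed E ->
  closed [set v | D (complex.Re (g (mx_of_rV v) i j)) /\
                  E (complex.Im (g (mx_of_rV v) i j))].
Proof.
move=> g_lin D_closed E_closed.
have g_entry a u v : g (mx_of_rV (a *: u + v)) i j =
    a%:C * g (mx_of_rV u) i j + g (mx_of_rV v) i j.
  by rewrite mx_of_rV_linear g_lin !mxE.
have re_cont : continuous (fun v => complex.Re (g (mx_of_rV v) i j)).
  apply: linear_rV_continuous => a u v; rewrite g_entry.
  by case: (g _ i j) => x y; case: (g _ i j) => z t /=; rewrite mul0r subr0.
have im_cont : continuous (fun v => complex.Im (g (mx_of_rV v) i j)).
  apply: linear_rV_continuous => a u v; rewrite g_entry.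
  by case: (g _ i j) => x y; case: (g _ i j) => z t /=; rewrite mul0r addr0.
apply: closedI; first by move/continuous_closedP: re_cont; apply.
by move/continuous_closedP: im_cont; apply.
Qed.

(** In the order of [C], nonnegative numbers are real: the imaginary part is confined to {0}. *)
Lemma closed_entry_ge0 p (g : 'M[C]_n -> 'M[C]_p) i j : real_linear g ->
  closed [set v | 0 <= g (mx_of_rV v) i j].
Proof.
move=> g_lin; have := @closed_entry _ _ i j _ _ g_lin (@closed_ge R 0) (@closed_eq R 0).
congr closed; apply/seteqP; split=> v /=; rewrite lecE /=.
  by move=> [-> ->]; rewrite eqxx.
by move=> /andP[/eqP].
Qed.

Lemma closed_entry_eq p (g : 'M[C]_n -> 'M[C]_p) i j c : real_linear g ->
  closed [set v | g (mx_of_rV v) i j = c].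
Proof.
move=> g_lin.
have := @closed_entry _ _ i j _ _ g_lin
  (@closed_eq R (complex.Re c)) (@closed_eq R (complex.Im c)).
congr closed; apply/seteqP; split=> v /=; last by move=> ->.
by move=> [re_c im_c]; apply/eqP; rewrite eq_complex re_c im_c !eqxx.
Qed.

Lemma closed_real_linear_eq p (f g : 'M[C]_n -> 'M[C]_p) :
  real_linear f -> real_linear g -> closed [set v | f (mx_of_rV v) = g (mx_of_rV v)].
Proof.
move=> f_lin g_lin.
have dif_lin : real_linear (fun A => f A - g A).
  by move=> a A B; rewrite f_lin g_lin scalerBr opprD addrACA.
have := closed_forall (fun ij : 'I_p * 'I_p =>
  @closed_entry_eq _ _ ij.1 ij.2 0 dif_lin).
congr closed; apply/seteqP; split=> v /= => [fg0 | -> ij].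
  apply/matrixP => i j; apply/eqP; rewrite -subr_eq0.
  by have := fg0 (i, j); rewrite /= !mxE => ->.
by rewrite subrr mxE.
Qed.

(** For each fixed [w] the quadratic form is real-linear in the matrix, so this is an intersection
    of closed conditions. *)
Lemma closed_psd p (g : 'M[C]_n -> 'M[C]_p) :
  real_linear g -> closed [set v | psd (g (mx_of_rV v))].
Proof.
move=> g_lin.
have -> : [set v | psd (g (mx_of_rV v))] =
    [set v | (g (mx_of_rV v))^t* = g (mx_of_rV v)] `&`
    [set v | forall w : 'cV[C]_p, 0 <= (w^t* *m g (mx_of_rV v) *m w) 0 0].
  apply/seteqP; split=> v /=; last by move=> [? ?]; exact: psd_intro.
  by move=> pg; split=> [|w]; [exact: psd_adj | exact: psd_quad].
apply: closedI.
  apply: (@closed_real_linear_eq p (fun A => (g A)^t*) g) => //.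
  exact: adj_real_linear.
apply: closed_forall => w.
apply: (@closed_entry_ge0 1 (fun A => w^t* *m g A *m w)) => a A B.
by rewrite g_lin mulmxDr mulmxDl -scalemxAr -scalemxAl.
Qed.

(** With the phase [c] chosen so that c A_ij = - |A_ij|, the quadratic form at e_i + c e_j gives 2
    |A_ij| <= A_ii + A_jj, and diagonal entries are at most the trace. *)
Lemma psd_entry_le (A : 'M[C]_n) i j : psd A -> \tr A = 1 -> `|A i j| <= 1.
Proof.
move=> pA trA; have diag_le k : A k k <= 1.
  rewrite -trA /mxtrace (bigD1 k) //= lerDl; apply: sumr_ge0 => l _.
  exact: psd_diag_ge0.
have [->|Aij] := eqVneq (A i j) 0; first by rewrite normr0 ler01.
have nA : `|A i j| != 0 by rewrite normr_eq0.
pose c := - (A i j)^* / `|A i j|.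
have cA : c * A i j = - `|A i j|.
  have AA : (A i j)^* * A i j = `|A i j| ^+ 2 by rewrite normCK mulrC.
  by rewrite /c mulrAC mulNr AA expr2 mulNr mulfK.
have Aji : A j i = (A i j)^* by rewrite -[in LHS](psd_adj pA) !mxE.
have cJA : c^* * A j i = - `|A i j|.
  by rewrite Aji -rmorphM cA rmorphN /= geC0_conj.
have cc : c^* * c = 1.
  by rewrite mulrC -normCK /c normrM normrN normfV norm_conjC normr_id mulfV ?expr1n.
have := psd_quad (delta_mx i 0 + c *: delta_mx j 0 : 'cV[C]_n) pA.
rewrite quad_delta_comb cA cJA cc mul1r [- _ + A j j]addrC addrACA.
rewrite -opprD subr_ge0 => le_diag.
have := le_trans le_diag (lerD (diag_le i) (diag_le j)).
by rewrite -!mulr2n lerMn2r.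
Qed.


(** By [psd_entry_le] the closed set lies in a product of segments [-1, 1]. *)
Lemma psd_trace1_compact (S : set 'M[C]_n) :
    (forall A, S A -> psd A /\ \tr A = 1) -> closed [set v | S (mx_of_rV v)] ->
  compact [set v | S (mx_of_rV v)].
Proof.
move=> S_state S_closed.
have entry_le (z : C) : `|z| <= 1 ->
      (complex.Re z \in `[-1, 1]%R) && (complex.Im z \in `[-1, 1]%R).
  move=> z_le; rewrite !in_itv /= -!ler_norml -!lecR.
  have Im_le : `|complex.Im z|%:C <= `|z|.
    by rewrite normc_def lecR -sqrtr_sqr ler_wsqrtr // lerDr sqr_ge0.
  by rewrite (le_trans (normc_ge_Re z)) // (le_trans Im_le).
apply: (subclosed_compact S_closed (rV_compact (fun=> @segment_compact R (-1) 1))).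
move=> v /S_state[psd_v tr_v] k; rewrite /= -[k]splitK.
case: (fintype.split k) => l /=; case: (mxtens_indexP l) => i j.
  by have /entry_le/andP[+ _] := psd_entry_le i j psd_v tr_v; rewrite mxE.
by have /entry_le/andP[_ +] := psd_entry_le i j psd_v tr_v; rewrite mxE.
Qed.

End Compactness.

(** * Attainment of the maximum *)

Section Attained.
Variables (R : realType) (d : nat).
Local Notation C := R[i]%C.
Local Notation Pi := (asym_proj R d).

(** The weight equals tr (Pi sigma Pi) >= 0, so taking the real part in [pPPT] loses nothing and
    bounds pass between [R] and [C]. *)
Lemma asym_weight_real (sigma : 'M[C]_(d * d)) : psd sigma ->
  (complex.Re (\tr (Pi *m sigma)))%:C%C = \tr (Pi *m sigma).
Proof.
move=> psd_sigma; apply: RRe_real; apply: ger0_real.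
rewrite -asym_projK -mulmxA mxtrace_mulC -{2}adj_asym_proj.
exact/psd_mxtrace_ge0/psd_congr.
Qed.

Definition feasible (rho : 'M[C]_(d * d)) := [set sigma : 'M[C]_(d * d) |
  PPT_state sigma /\ Pi *m sigma *m Pi = \tr (Pi *m sigma) *: rho].

(** The weight is linear in sigma and [rho] is fixed, so the block constraint is an equation between
    linear maps. *)
Lemma feasible_closed rho : closed [set v | feasible rho (mx_of_rV v)].
Proof.
have id_lin : real_linear (fun A : 'M[C]_(d * d) => A) by [].
(* The trace is viewed as a 1 x 1 matrix to fit [closed_entry_eq]. *)
have tr_lin : real_linear (fun A : 'M[C]_(d * d) => (\tr A)%:M : 'M_1).
  move=> a A B; apply/matrixP => k l; rewrite !ord1 mxtraceD mxtraceZ.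
  by rewrite !mxE eqxx !mulr1n.
have PT_lin : real_linear (@partial_transpose R d).
  exact: linear_real_linear.
have asym_lin : real_linear (fun A => Pi *m A *m Pi).
  move=> a A B; rewrite mulmxDr mulmxDl.
  by rewrite -[Pi *m (_ *: A)]scalemxAr -[(_ *: (Pi *m A)) *m Pi]scalemxAl.
have weight_lin : real_linear (fun A => \tr (Pi *m A) *: rho).
  move=> a A B; rewrite mulmxDr -[Pi *m (_ *: A)]scalemxAr mxtraceD mxtraceZ.
  by rewrite scalerDl scalerA.
have := closedI (closedI (closed_psd id_lin) (@closed_entry_eq R _ 1 _ 0 0 1 tr_lin))
  (closedI (closed_psd PT_lin) (closed_real_linear_eq asym_lin weight_lin)).
congr closed; apply/seteqP; split=> v /=.
  by move=> [[? +] [? ?]]; rewrite mxE eqxx mulr1n => ?.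
by move=> [[[? +] ?] ?]; rewrite mxE eqxx mulr1n => ?.
Qed.

(** The extreme value theorem for the continuous weight on the compact feasible set, in real
    coordinates. *)
Lemma feasible_max rho : feasible rho !=set0 ->
  exists2 sigma, feasible rho sigma & forall tau, feasible rho tau ->
    complex.Re (\tr (Pi *m tau)) <= complex.Re (\tr (Pi *m sigma)).
Proof.
move=> [sigma0 sigma0P].
pose f (v : 'rV[R]_(d * d * (d * d) + d * d * (d * d))) :=
  complex.Re (\tr (Pi *m mx_of_rV v)).
have f_cont : continuous f.
  apply: linear_rV_continuous => a u v; rewrite /f mx_of_rV_linear mulmxDr.
  rewrite -[Pi *m (_ *: _)]scalemxAr mxtraceD mxtraceZ.
  by case: (\tr _) => x y; case: (\tr _) => z t /=; rewrite mul0r subr0.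
pose A := [set v | feasible rho (mx_of_rV v)].
have A_compact : compact A.
  apply: (psd_trace1_compact (S := feasible rho)); last exact: feasible_closed.
  by move=> sigma [[[? ?] _] _].
have A_neq0 : A !=set0 by exists (rV_of_mx sigma0); rewrite /A /= rV_of_mxK.
have [v] := compact_EVT_max A_neq0 A_compact (continuous_subspaceT f_cont).
rewrite inE => Av v_max; exists (mx_of_rV v); [exact: Av | move=> tau tauP].
by rewrite -[tau]rV_of_mxK; apply: v_max; rewrite inE /A /= rV_of_mxK.
Qed.

Lemma pPPT_attained rho : feasible rho !=set0 ->
  (exists2 sigma, feasible rho sigma & pPPT rho = complex.Re (\tr (Pi *m sigma))) /\
  (forall tau, feasible rho tau -> complex.Re (\tr (Pi *m tau)) <= pPPT rho).
Proof.
move=> /feasible_max[sigma sigmaP sigma_max].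
have pE : pPPT rho = complex.Re (\tr (Pi *m sigma)).
  (* A greatest element exists and is unique, so [xget] returns it and not its default 0. *)
  apply: xget_unique => [|x [[tau tauP <-] x_ub]].
    by split; [exists sigma | move=> _ [tau tauP <-]; exact: sigma_max].
  by apply/eqP; rewrite eq_le sigma_max //= x_ub //; exists sigma.
by rewrite pE; split=> //; exists sigma.
Qed.

Lemma pPPT_ge (rho : 'M[C]_(d * d)) : antisym_state rho -> (d%:R + 2)^-1 <= pPPT rho.
Proof.
move=> /antisym_state_completion[sigma sigmaP]; have [[[psd_sigma _] _] _] := sigmaP.
rewrite -asym_weight_real // => le_weight.
have rho_feasible : feasible rho !=set0 by exists sigma.
have [_ /(_ sigma sigmaP)] := pPPT_attained rho_feasible.
apply: le_trans; rewrite -lecR.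
by rewrite fmorphV rmorphD !rmorph_nat.
Qed.

End Attained.

(** * The minimum over antisymmetric states *)

Theorem theorem6p1 (R : realType) (d : nat) (hd4 : (4 <= d)%N) (hdeven : ~~ odd d) :
  pmin R d = pPPT (omega_state R d) /\ pPPT (omega_state R d) = (d%:R + 2)^-1.
Proof.
have d_gt0 : (0 < d)%N by exact: leq_trans hd4.
have d_gt2 : (2 < d)%N by exact: leq_trans hd4.
have W_unitary := Omega_unitary R hdeven; have W_asym := Omega_asym R d.
have omega_antisym : antisym_state (omega_state R d).
  by rewrite omega_stateE; exact: max_entangled_antisym_state.
have omega_feasible : feasible (omega_state R d) !=set0.
  by have [sigma sigmaP _] := antisym_state_completion omega_antisym; exists sigma.
have omegaE : pPPT (omega_state R d) = (d%:R + 2)^-1.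
  apply/eqP; rewrite eq_le pPPT_ge // andbT.
  (* The maximum is the weight of an actual feasible state, to which the witness bound applies. *)
  have [[sigma sigmaP ->] _] := pPPT_attained omega_feasible.
  have [PPT_sigma asym_sigma] := sigmaP; have [[psd_sigma _] _] := PPT_sigma.
  rewrite -lecR asym_weight_real // fmorphV rmorphD !rmorph_nat.
  by move: asym_sigma; rewrite omega_stateE; exact: max_entangled_weight_le.
(* By [pPPT_ge] the value at omega bounds all others from below; a least element is unique, so
   [xget] returns this value. *)
split=> //; apply: xget_unique => [|x [[rho rhoP <-] x_lb]].
  split; first by exists (omega_state R d).
  by move=> _ [rho rhoP <-]; rewrite omegaE pPPT_ge.
apply/eqP; rewrite eq_le omegaE pPPT_ge // andbT -omegaE x_lb //.
by exists (omega_state R d).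
Qed.
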